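(* Let $q$ and $c$ be complex numbers with $|q|<1$ and $|cq|<1$. For each non-negative integer $m$ define \[ M_{m,c} = \sum_{n=1}^{\infty} n^m c^n q^n (q^{n+1};q)_\infty, \qquad K_{m+1,c} = \sum_{n=1}^{\infty} \sigma_{m,c}(n) q^n, \] where $\sigma_{m,c}(n) = \sum_{d\mid n} d^m c^d$. Then, as an identity of formal power series in $t$ (equivalently, for all complex $t$ in a neighbourhood of $0$), \[ \frac{(q;q)_\infty}{(cq;q)_\infty} \exp\Bigl(\sum_{m=1}^{\infty} K_{m,c} \frac{t^m}{m!}\Bigr) = \frac{(q;q)_\infty}{(cq;q)_\infty} + \sum_{m=1}^{\infty} M_{m,c} \frac{t^m}{m!}, \] and for every integer $m\ge 1$, \[ M_{m,c} = \frac{(q;q)_\infty}{(cq;q)_\infty}\, Y_m(K_{1,c}, K_{2,c}, \dots, K_{m,c}), \] where $Y_m$ is the Bell polynomial \[ Y_m(u_1,\dots,u_m) = \sum \frac{m!}{k_1!\cdots k_m!}\Bigl(\frac{u_1}{1!}\Bigr)^{k_1}\cdots \Bigl(\frac{u_m}{m!}\Bigr)^{k_m}, \] the sum being over all tuples $(k_1,\dots,k_m)$ of non-negative integers with $k_1 + 2k_2 + \cdots + m k_m = m$.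
   Context: For complex $a$ and $|q|<1$, $(a;q)_\infty = \prod_{j=0}^{\infty}(1-aq^j)$; thus $(q^{n+1};q)_\infty=\prod_{j\ge n+1}(1-q^j)$. The sum $\sum_{d\mid n}$ runs over positive divisors $d$ of $n$. *)

(* Defs.v *)
(* complex numbers are R[i] (mathcomp-real-closed
   `complex`) over an arbitrary R : realType (taken as R[i]^o, the regular
   copy of the numFieldType R[i], which carries MathComp-Analysis'
   normed/topological structure given by the complex modulus). *)
From HB Require Import structures.
From mathcomp Require Import all_boot all_order all_algebra.
From mathcomp Require Import complex.
From mathcomp Require Import all_classical all_reals all_analysis.
Set Implicit Arguments. Unset Strict Implicit. Unset Printing Implicit Defensive.
Import Order.TTheory GRing.Theory Num.Theory ComplexField.
Import numFieldNormedType.Exports.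
Local Open Scope ring_scope.
Local Open Scope complex_scope.
Local Open Scope classical_set_scope.
Local Open Scope ring_scope.

Section Defs.
Variable R : realType.
Local Notation C := ((R[i])^o).

Definition qpoch (a q : C) : C :=
  limn (fun N => \prod_(j < N) (1 - a * q ^+ j)).

Definition cexp (z : C) : C := limn (fun N => \sum_(0 <= k < N) (z ^+ k / (k`!)%:R)).

Definition sigmac (m : nat) (c : C) (n : nat) : C :=
  \sum_(d <- divisors n) (d%:R ^+ m * c ^+ d).

Definition Mc (q c : C) (m : nat) : C :=
  limn (fun N =>
    \sum_(1 <= n < N) (n%:R ^+ m * c ^+ n * q ^+ n * qpoch (q ^+ n.+1) q)).

Definition Kc (q c : C) (j : nat) : C :=
  limn (fun N => \sum_(1 <= n < N) (sigmac j.-1 c n * q ^+ n)).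

(* Bell polynomial Y_m(u_1,...,u_m): sum over (k_1,...,k_m) with
   k_1 + 2 k_2 + ... + m k_m = m of
   m!/(k_1!...k_m!) prod_i (u_i / i!)^{k_i}.
   The tuple is k : 'I_m -> 'I_(m.+1) with k i standing for k_{i+1}
   (each k_i <= m is forced by the constraint, so no tuple is lost). *)
Definition bellY (m : nat) (u : nat -> C) : C :=
  \sum_(k : {ffun 'I_m -> 'I_m.+1} |
          (\sum_(i < m) i.+1 * k i)%N == m)
    ((m`!)%:R / (\prod_(i < m) (k i)`!)%:R *
       \prod_(i < m) (u i.+1 / ((i.+1)`!)%:R) ^+ k i).
End Defs.

(* Main.v *)
(** Put x = cq and a_n = 1/(q;q)_n.  Since (q^{n+1};q)_oo = (q;q)_oo a_n, the
    series M_m is (q;q)_oo Z_m with Z_m = sum_n n^m a_n x^n, and Euler's identity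
    Z_0 = 1/(x;q)_oo identifies the prefactor with (q;q)_oo Z_0.  The a_n are
    complete homogeneous symmetric functions of 1, q, q^2, ..., so Newton's
    identity reads n a_n = sum_d a_{n-d}/(1-q^d).  Multiplying it by n^m x^n and
    expanding n^m = (d + (n-d))^m gives
      Z_{m+1} = sum_k binom(m,k) K_{k+1} Z_{m-k},
    because K_{k+1} is the Lambert series sum_d d^k x^d/(1-q^d).  This is the
    recurrence of the complete Bell polynomials, and also the one satisfied by
    the coefficients of exp(sum_m K_m t^m/m!).  As |K_m|/m! grows at most
    geometrically, the latter exponential can be expanded for small t. *)
Require Import Defs.
From HB Require Import structures.
From mathcomp Require Import all_boot all_order all_algebra.
From mathcomp Require Import complex ring lra.
From mathcomp Require Import all_classical all_reals all_analysis.
Import Order.TTheory GRing.Theory Num.Theory ComplexField.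
Import numFieldNormedType.Exports.
Local Open Scope ring_scope.
Local Open Scope complex_scope.
Local Open Scope classical_set_scope.
Local Open Scope ring_scope.
Set Implicit Arguments. Unset Strict Implicit. Unset Printing Implicit Defensive.

(** * Sequences and series of complex numbers *)

Lemma eq_cvgn (T : topologicalType) (u v : nat -> T) (l : T) :
  u =1 v -> u @ \oo --> l -> v @ \oo --> l.
Proof. by move/funext ->. Qed.

Section SeqAlgebra.
Variable K : numFieldType.
Implicit Types (u v : nat -> K) (a b : K).

Lemma seqD u v a b : u @ \oo --> a -> v @ \oo --> b ->
  (fun n => u n + v n) @ \oo --> a + b.
Proof. exact: cvgD. Qed.

Lemma seqB u v a b : u @ \oo --> a -> v @ \oo --> b ->
  (fun n => u n - v n) @ \oo --> a - b.
Proof. exact: cvgB. Qed.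

Lemma seqMl u a b : u @ \oo --> a -> (fun n => b * u n) @ \oo --> b * a.
Proof. exact: cvgMl_tmp. Qed.

Lemma seqMr u a b : u @ \oo --> a -> (fun n => u n * b) @ \oo --> a * b.
Proof. exact: cvgMr_tmp. Qed.

Lemma seq_sum n (f : nat -> nat -> K) (a : nat -> K) :
  (forall i, (i < n)%N -> f i @ \oo --> a i) ->
  (fun N => \sum_(i < n) f i N) @ \oo --> \sum_(i < n) a i.
Proof. by move=> fa; apply: cvg_big => [|i _]; [exact: add_continuous|exact: fa]. Qed.

Lemma seq_unique u a b : u @ \oo --> a -> u @ \oo --> b -> a = b.
Proof. by move=> ua ub; apply: cvg_unique ua ub; exact: norm_hausdorff. Qed.
End SeqAlgebra.

Section ComplexSeries.
Variable R : realType.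
Local Notation C := ((R[i])^o).
Local Notation nc := (@Normc.normc R).

Lemma norm_ncE (z : C) : `|z| = (nc z)%:C.
Proof. by []. Qed.

Lemma nc_ge0 (z : C) : 0 <= nc z.
Proof. by rewrite -lecR -norm_ncE normr_ge0. Qed.

Lemma ncN (z : C) : nc (- z) = nc z.
Proof. by apply: complexI; rewrite -!norm_ncE normrN. Qed.

Lemma ncD (z w : C) : nc (z + w) <= nc z + nc w.
Proof. by rewrite -lecR rmorphD/= -!norm_ncE ler_normD. Qed.

Lemma ncX (z : C) n : nc (z ^+ n) = nc z ^+ n.
Proof. by apply: complexI; rewrite -norm_ncE normrX norm_ncE rmorphXn. Qed.

Lemma nc_nat n : nc n%:R = n%:R.
Proof. by apply: complexI; rewrite -(norm_ncE n%:R) normr_nat rmorph_nat. Qed.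

Lemma nc_sum (I : Type) (r : seq I) (P : pred I) (F : I -> C) :
  nc (\sum_(i <- r | P i) F i) <= \sum_(i <- r | P i) nc (F i).
Proof.
elim/big_rec2: _ => [|i y x _ yx]; first by rewrite Normc.normc0.
by apply: le_trans (ncD _ _) _; rewrite lerD2l.
Qed.

(** Passing to the real-valued modulus makes squeeze and order arguments over [R] available for
    complex sequences. *)
Lemma cvg_ncP (u : nat -> C) (l : C) :
  u @ \oo --> l <-> (fun n => nc (u n - l)) @ \oo --> 0.
Proof.
split=> [/cvgrPdist_lt ul|/cvgrPdist_lt ul].
- apply/cvgrPdist_lt => e e0; have /ul : (0 < e%:C :> R[i]) by rewrite ltcR.
  apply: filterS => n; rewrite norm_ncE ltcR sub0r normrN ger0_norm ?nc_ge0//.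
  by rewrite -ncN opprB.
- apply/cvgrPdist_lt => e e0.
  (* A positive element of [R[i]] has zero imaginary part, so [e] is a real number. *)
  have [er e0'] : e = (complex.Re e)%:C /\ 0 < complex.Re e.
    move: e0; case: e => a b /=; rewrite ltcE/= => /andP[/eqP -> ->]//.
  have /ul : 0 < complex.Re e by [].
  apply: filterS => n; rewrite sub0r normrN ger0_norm ?nc_ge0// => H.
  by rewrite er norm_ncE ltcR -ncN opprB.
Qed.

Lemma nc_lim_le (u : nat -> C) (l : C) (B : R) :
  u @ \oo --> l -> (forall n, nc (u n) <= B) -> nc l <= B.
Proof.
move=> /cvg_ncP/cvgrPdist_le ul uB; apply/ler_addgt0Pr => e /ul[N _ /(_ N (leqnn N))].
rewrite /= sub0r normrN ger0_norm ?nc_ge0// => H.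
rewrite -(subrK (u N) l) addrC; apply: le_trans (ncD _ _) (lerD (uB N) _).
by rewrite -ncN opprB.
Qed.

Lemma nc_Re (z : C) : `|complex.Re z| <= nc z.
Proof. by rewrite -lecR -norm_ncE; exact: normc_ge_Re. Qed.

Lemma nc_Im (z : C) : `|complex.Im z| <= nc z.
Proof.
case: z => a b /=; rewrite -[leLHS]sqrtr_sqr ler_wsqrtr//.
by rewrite lerDr sqr_ge0.
Qed.

Lemma nc_le (z : C) : nc z <= `|complex.Re z| + `|complex.Im z|.
Proof.
case: z => a b /=; rewrite -[leRHS]ger0_norm ?addr_ge0// -[leRHS]sqrtr_sqr.
rewrite ler_wsqrtr// -(real_normK (num_real a)) -(real_normK (num_real b)).
rewrite sqrrD -addrA lerD2l lerDr.
by rewrite mulrn_wge0// mulr_ge0.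
Qed.

Lemma cvg_of_Re_Im (u : nat -> C) (a b : R) :
  (fun n => complex.Re (u n)) @ \oo --> a ->
  (fun n => complex.Im (u n)) @ \oo --> b -> u @ \oo --> ((a +i* b)%C : C).
Proof.
move=> ua ub; apply/cvg_ncP.
apply: (@squeeze_cvgr _ _ _ _ (fun=> 0)
  (fun n => `|complex.Re (u n) - a| + `|complex.Im (u n) - b|)).
- apply: nearW => n; rewrite nc_ge0/=.
  by apply: le_trans (nc_le _) _; case: (u n).
- exact: cvg_cst.
- rewrite -[X in _ --> X](addr0 0); apply: cvgD.
  + have := @cvg_norm _ _ _ _ _ _ _ (cvgB ua (cvg_cst a)); rewrite subrr normr0; exact.
  + have := @cvg_norm _ _ _ _ _ _ _ (cvgB ub (cvg_cst b)); rewrite subrr normr0; exact.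
Qed.

Lemma real_abs_cvg (u a : nat -> R) (B : R) : (forall n, `|u n| <= a n) ->
  (forall N, \sum_(i < N) a i <= B) -> cvgn (fun N => \sum_(i < N) u i).
Proof.
move=> ua aB.
have a0 n : 0 <= a n by apply: le_trans (ua n).
have : cvgn [normed series u].
  apply: nondecreasing_is_cvgn.
    by apply: nondecreasing_series => n _ _; exact: normr_ge0.
  exists B => _ [N _ <-]; apply: le_trans (aB N).
  by rewrite /= /series/= big_mkord; apply: ler_sum.
move/normed_cvg; rewrite (_ : series u = (fun N => \sum_(i < N) u i))//.
by apply/funext => N; rewrite /series/= big_mkord.
Qed.

(** The real and imaginary parts are both dominated by the majorant, which reduces the claim to
    absolute convergence over [R]. *)
Lemma complex_abs_cvg (u : nat -> C) (a : nat -> R) (B : R) :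
  (forall n, nc (u n) <= a n) -> (forall N, \sum_(i < N) a i <= B) ->
  exists l : C, (fun N => \sum_(i < N) u i) @ \oo --> l.
Proof.
move=> ua aB.
have /cvg_ex[x ux] : cvgn (fun N => \sum_(i < N) complex.Re (u i)).
  apply: (real_abs_cvg (u := fun i => complex.Re (u i)) _ aB) => n.
  by apply: le_trans (ua n); exact: nc_Re.
have /cvg_ex[y uy] : cvgn (fun N => \sum_(i < N) complex.Im (u i)).
  apply: (real_abs_cvg (u := fun i => complex.Im (u i)) _ aB) => n.
  by apply: le_trans (ua n); exact: nc_Im.
exists (x +i* y)%C; apply: cvg_of_Re_Im.
- by under eq_fun do rewrite raddf_sum.
- by under eq_fun do rewrite raddf_sum.
Qed.

(** Dominated convergence for triangular sums: beyond some [M] the tail of [a] bounds the difference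
    uniformly in [N], and the first [M] terms tend to 0 one by one. Comparing with partial sums of
    [F] avoids assuming that its series converges. *)
Lemma tannery (f : nat -> nat -> C) (F : nat -> C) (a : nat -> R) (B : R) :
  (forall N i, nc (f N i - F i) <= a i) -> (forall N, \sum_(i < N) a i <= B) ->
  (forall i, f ^~ i @ \oo --> F i) ->
  (fun N => \sum_(i < N) f N i - \sum_(i < N) F i) @ \oo --> (0 : C).
Proof.
move=> fa aB fF; apply/cvg_ncP/cvgrPdist_lt => e e0.
have a0 n : 0 <= a n by apply: le_trans (fa 0%N n); exact: nc_ge0.
have e20 : 0 < e / 2 by rewrite divr_gt0.
have [M HM] : exists M, forall N, (M <= N)%N -> \sum_(M <= i < N) a i <= e / 2.
  have /cvg_ex[l al] : cvgn (fun N => \sum_(i < N) a i).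
    by apply: (real_abs_cvg (u := a) _ aB) => n; rewrite ger0_norm.
  (* The block from [M] to [N] is a difference of two distances to the limit [l], hence a quarter of
     [e] for each. *)
  have e40 : 0 < e / 2 / 2 by rewrite !divr_gt0.
  move/cvgrPdist_lt : al => /(_ _ e40)[M _ HM]; exists M => N MN.
  have H1 := HM _ (leqnn M); have H2 := HM N MN.
  rewrite (_ : \sum_(M <= i < N) a i = \sum_(i < N) a i - \sum_(i < M) a i); last first.
    by rewrite -!(big_mkord xpredT) (@big_cat_nat _ _ _ M 0 N)//= addrAC subrr add0r.
  apply: le_trans (ler_norm _) _.
  rewrite (_ : _ - _ = (l - \sum_(i < M) a i) - (l - \sum_(i < N) a i)); last by ring.
  apply: le_trans (ler_normB _ _) _.
  by rewrite [leRHS]splitr ltW// ltrD.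
have : (fun N => \sum_(i < M) nc (f N i - F i)) @ \oo --> 0.
  rewrite [X in _ --> X](_ : 0 = \sum_(i < M) 0); last by rewrite big1.
  by apply: (seq_sum (f := fun i N => nc (f N i - F i)) (a := fun=> 0)) => i _; apply/cvg_ncP.
move=> /cvgrPdist_lt/(_ _ e20) [N0 _ HN0].
exists (maxn M N0) => // N /=; rewrite geq_max => /andP[MN N0N].
rewrite sub0r normrN ger0_norm ?nc_ge0// subr0 -sumrB.
apply: le_lt_trans (nc_sum _ _ _) _.
rewrite -(big_mkord xpredT (fun i => nc (f N i - F i))) (@big_cat_nat _ _ _ M 0 N)//=.
rewrite [ltRHS]splitr ltr_leD//.
  have := HN0 N N0N; rewrite /= sub0r normrN big_mkord ger0_norm//.
  by apply: sumr_ge0 => i _; exact: nc_ge0.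
apply: le_trans (HM N MN); apply: ler_sum => i _; exact: fa.
Qed.
End ComplexSeries.

(** * Power bounds and Cauchy products *)

Section RealBounds.
Variable R : realType.
Implicit Type y : R.

(** Pascal's rule makes multiplication by [1 - y] lower the order of the binomial by one, up to a
    boundary term. That term is nonnegative for [0 <= y] and can then be dropped in upper bounds. *)
Lemma sum_bin_exp y m N :
  (1 - y) * \sum_(d < N) 'C(d + m.+1, m.+1)%:R * y ^+ d =
  \sum_(d < N) 'C(d + m, m)%:R * y ^+ d - 'C(N + m, m.+1)%:R * y ^+ N.
Proof.
elim: N => [|N IH].
  by rewrite !big_ord0 add0n bin_small// mul0r mulr0 subr0.
rewrite !big_ord_recr/= mulrDr IH addSn addnS binS natrD exprS.
by ring.
Qed.

Lemma sum_bin_exp_le y m N : 0 <= y < 1 ->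
  \sum_(d < N) 'C(d + m, m)%:R * y ^+ d <= ((1 - y) ^+ m.+1)^-1.
Proof.
move=> /andP[y0 y1]; have y1' : 0 < 1 - y by rewrite subr_gt0.
elim: m => [|m IH].
  rewrite expr1 -[leRHS]mul1r ler_pdivlMr//.
  under eq_bigr do rewrite bin0 mul1r.
  by rewrite mulrC -opprB mulNr -subrX1 opprB lerBlDr lerDl exprn_ge0.
rewrite exprS invfM mulrC ler_pdivlMr// mulrC sum_bin_exp.
by apply: le_trans IH; rewrite lerBlDr lerDl mulr_ge0// exprn_ge0.
Qed.

(** The right side is [(d+1)...(d+m)], a product of [m] factors, each at least [d]. *)
Lemma expn_le_bin d m : (d ^ m <= m`! * 'C(d + m, m))%N.
Proof.
rewrite mulnC bin_ffact; elim: m => [|m IH]; first by rewrite expn0 ffactn0.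
by rewrite addnS ffactSS expnS leq_mul// -addnS leq_addr.
Qed.

Lemma sum_pow_exp_le y m N : 0 <= y < 1 ->
  \sum_(d < N) d%:R ^+ m * y ^+ d <= m`!%:R / (1 - y) ^+ m.+1.
Proof.
move=> y01; have /andP[y0 _] := y01.
apply: le_trans (ler_wpM2l _ (sum_bin_exp_le m N y01)) => //.
rewrite mulr_sumr; apply: ler_sum => d _.
by rewrite mulrA ler_wpM2r ?exprn_ge0// -natrX -natrM ler_nat expn_le_bin.
Qed.

Lemma sum_exp_le y N : 0 <= y < 1 -> \sum_(d < N) y ^+ d <= (1 - y)^-1.
Proof.
move=> y01; have := sum_pow_exp_le 0 N y01; rewrite expr1 mul1r.
by under eq_bigr do rewrite expr0 mul1r.
Qed.

Lemma sum_exp_coeff_le y N : 0 <= y -> \sum_(k < N) y ^+ k / k`!%:R <= expR y.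
Proof.
move=> y0; have cv := is_cvg_series_exp_coeff y.
have := @nondecreasing_cvgn_le R (series (exp_coeff y)) _ cv N.
rewrite /series/= big_mkord; apply.
apply: nondecreasing_series => n _ _; rewrite /exp_coeff/=.
by rewrite divr_ge0// exprn_ge0.
Qed.

End RealBounds.

Section Mertens.
Variable R : realType.
Local Notation C := ((R[i])^o).
Local Notation nc := (@Normc.normc R).

(** Both sides sum [u i * v j] over the triangle [i + j < N], once by antidiagonals and once by
    rows. *)
Lemma sum_convolution (u v : nat -> C) N :
  \sum_(n < N) \sum_(i < n.+1) u i * v (n - i)%N =
  \sum_(i < N) u i * \sum_(j < N - i) v j.
Proof.
elim: N => [|N IH]; first by rewrite !big_ord0.
rewrite [LHS]big_ord_recr/= IH.
have -> : \sum_(i < N) u i * (\sum_(j < N - i) v j) =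
          \sum_(i < N.+1) u i * (\sum_(j < N - i) v j).
  by rewrite [RHS]big_ord_recr/= subnn big_ord0 mulr0 addr0.
rewrite -big_split/=; apply: eq_bigr => i _.
by rewrite -mulrDr subSn -1?ltnS// big_ord_recr.
Qed.

(** Summed by rows, the Cauchy product has [i]-th term [u i] times a partial sum of [v] tending to
    [V], at distance at most [B' + nc V] from it. Tannery's theorem then applies, with absolute
    summability required of [u] only. *)
Lemma mertens (u v : nat -> C) (U V : C) (a : nat -> R) (B B' : R) :
  (forall i, nc (u i) <= a i) -> (forall N, \sum_(i < N) a i <= B) ->
  (forall N, nc (\sum_(j < N) v j) <= B') ->
  (fun N => \sum_(i < N) u i) @ \oo --> U ->
  (fun N => \sum_(i < N) v i) @ \oo --> V ->
  (fun N => \sum_(n < N) \sum_(i < n.+1) u i * v (n - i)%N) @ \oo --> (U * V : C).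
Proof.
move=> ua aB vB uU vV.
have B'0 : 0 <= B' by apply: le_trans (vB 0%N); exact: nc_ge0.
have := @tannery R (fun N i => u i * \sum_(j < N - i) v j) (fun i => u i * V)
  (fun i => a i * (B' + nc V)) (B * (B' + nc V)).
move=> /(_ _ _ _)/wrap[].
- move=> N i; rewrite -mulrBr Normc.normcM ler_pM ?nc_ge0//.
  by apply: le_trans (ncD _ _) _; rewrite ncN lerD.
- by move=> N; rewrite -mulr_suml ler_wpM2r// addr_ge0// nc_ge0.
- move=> i; apply: seqMl; rewrite (cvg_centern i (fun N => \sum_(j < N) v j)).
  exact: vV.
move=> H.
have := seqD H (seqMr (b := V) uU); rewrite add0r => H2.
apply: (eq_cvgn _ H2) => N /=.
by rewrite sum_convolution -mulr_suml subrK.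
Qed.
End Mertens.

(** * Newton's identity and Euler's product *)

Section QNewton.
Variables (F : fieldType) (q : F).
Hypothesis hq : forall n, 1 - q ^+ n.+1 != 0.

Definition qfact (n : nat) : F := \prod_(j < n) (1 - q ^+ j.+1).

Lemma inv_qfactS n : (1 - q ^+ n.+1) * (qfact n.+1)^-1 = (qfact n)^-1.
Proof. by rewrite /qfact big_ord_recr/= invfM mulrCA divff ?mulr1. Qed.

(** Truncated form of the functional equation [(1 - x) A(x) = A(xq)] for Euler's series [A]. *)
Lemma sum_euler_shift (x : F) N :
  (1 - x) * \sum_(n < N) (qfact n)^-1 * x ^+ n =
  \sum_(n < N) (qfact n)^-1 * (x * q) ^+ n - (qfact N)^-1 * (1 - q ^+ N) * x ^+ N.
Proof.
elim: N => [|N IH]; first by rewrite !big_ord0 expr0 subrr !(mulr0, mul0r) subrr.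
rewrite !big_ord_recr/= mulrDr IH [(qfact N.+1)^-1 * _]mulrC inv_qfactS exprMn exprS.
by ring.
Qed.

(** The sum telescopes, since [q^n/(q;q)_n = 1/(q;q)_n - 1/(q;q)_{n-1}]. *)
Lemma sum_inv_qfact n :
  \sum_(e < n.+1) q ^+ e * (qfact e)^-1 = (qfact n)^-1.
Proof.
elim: n => [|n IH]; first by rewrite big_ord1 expr0 mul1r.
by rewrite big_ord_recr/= IH -inv_qfactS; ring.
Qed.

(* The summand d = 0 vanishes, as 0^-1 = 0. *)
Lemma qfact_newton n :
  n%:R * (qfact n)^-1 = \sum_(d < n.+1) (1 - q ^+ d)^-1 * (qfact (n - d))^-1.
Proof.
elim: n => [|n IH]; first by rewrite big_ord1 mul0r expr0 subrr invr0 mul0r.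
(* After this multiplication the left side is [1/(q;q)_n + n/(q;q)_n]. The first summand will be
   expanded by [sum_inv_qfact] and the second by the induction hypothesis. *)
apply: (mulfI (hq n)).
have -> : (1 - q ^+ n.+1) * (n.+1%:R * (qfact n.+1)^-1) =
          (qfact n)^-1 + n%:R * (qfact n)^-1.
  by rewrite mulrCA inv_qfactS -natr1; ring.
rewrite IH -{1}sum_inv_qfact mulr_sumr [in RHS]big_ord_recl/=.
rewrite expr0 subrr invr0 mul0r mulr0 add0r.
(* With [y = q^(d+1)] and [z = q^(n-d)], this is [1 - yz = z(1 - y) + (1 - z)] divided by
   [1 - y]. *)
have split_term (d : nat) : (d <= n)%N ->
    (1 - q ^+ n.+1) * ((1 - q ^+ d.+1)^-1 * (qfact (n - d))^-1) =
    q ^+ (n - d) * (qfact (n - d))^-1 +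
    (1 - q ^+ d.+1)^-1 * ((1 - q ^+ (n - d)) * (qfact (n - d))^-1).
  move=> dn; have -> : q ^+ n.+1 = q ^+ d.+1 * q ^+ (n - d).
    by rewrite -exprD addSn subnKC.
  move: (hq d); move: (q ^+ d.+1) (q ^+ (n - d)) ((qfact _)^-1) => y z w y0.
  by field.
under [RHS]eq_bigr => d _ do rewrite /bump/= add1n subSS split_term ?leq_ord//.
rewrite big_split/=; congr (_ + _).
  by rewrite (reindex_inj rev_ord_inj)/=; apply: eq_bigr => i _; rewrite subSS.
rewrite big_ord_recl/= expr0 subrr invr0 mul0r add0r.
rewrite [RHS]big_ord_recr/= subnn expr0 subrr mul0r mulr0 addr0.
apply: eq_bigr => i _; congr (_ * _).
by rewrite /bump/= add1n -inv_qfactS -subSn// subSS.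
Qed.

End QNewton.

Section Euler.
Variable R : realType.
Local Notation C := ((R[i])^o).
Local Notation nc := (@Normc.normc R).
Variable q : C.
Hypothesis hq : nc q < 1.

Lemma nc_1B (z : C) : 1 - nc z <= nc (1 - z).
Proof.
rewrite lerBlDr -[leLHS](@Normc.normc1 R).
by apply: le_trans (ncD _ _); rewrite subrK.
Qed.

Lemma one_sub_neq0 (z : C) : nc z < 1 -> 1 - z != 0.
Proof.
move=> z1; apply/eqP => z0; have := nc_1B z; rewrite z0 Normc.normc0.
by rewrite leNgt subr_gt0 z1.
Qed.

Lemma one_sub_qexp_neq0 n : 1 - q ^+ n.+1 != 0.
Proof. by apply: one_sub_neq0; rewrite ncX exprn_ilt1 ?nc_ge0. Qed.

Lemma nc_inv_1B_qexp n : nc (1 - q ^+ n.+1)^-1 <= (1 - nc q)^-1.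
Proof.
rewrite Normc.normcV lef_pV2 ?posrE ?subr_gt0//; last first.
  by apply: lt_le_trans (nc_1B _); rewrite subr_gt0 ncX exprn_ilt1 ?nc_ge0.
apply: le_trans (nc_1B _); rewrite lerD2l lerN2 ncX exprS ler_piMr ?nc_ge0//.
by rewrite exprn_ile1 ?nc_ge0// ltW.
Qed.

(** Each factor is [1/(1 - q^j) = 1 + q^j/(1 - q^j)], so [1 + x <= exp x] bounds the product by the
    exponential of a geometric sum. *)
Lemma inv_qfact_bounded : exists2 L : R, 0 <= L & forall n, nc (qfact q n)^-1 <= L.
Proof.
have q0 := nc_ge0 q; have q1 : 0 < 1 - nc q by rewrite subr_gt0.
exists (expR ((1 - nc q)^-1 * (1 - nc q)^-1)); first exact: expR_ge0.
move=> n; rewrite /qfact -prodfV.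
apply: (@le_trans _ _ (\prod_(j < n) expR ((1 - nc q)^-1 * nc q ^+ j))).
  elim: n => [|n IH]; first by rewrite !big_ord0 Normc.normc1.
  rewrite !big_ord_recr/= Normc.normcM ler_pM ?nc_ge0//.
  apply: le_trans (expR_ge1Dx _).
  have E : (1 - q ^+ n.+1)^-1 = 1 + (1 - q ^+ n.+1)^-1 * q ^+ n.+1.
    by field; exact: one_sub_qexp_neq0.
  rewrite E; apply: le_trans (ncD _ _) _; rewrite Normc.normc1 lerD2l Normc.normcM.
  rewrite ler_pM ?nc_ge0 ?nc_inv_1B_qexp// ncX exprS ler_piMl ?exprn_ge0//.
  exact: ltW.
rewrite -expR_sum ler_expR -mulr_sumr ler_wpM2l ?invr_ge0 ?(ltW q1)//.
by apply: sum_exp_le; rewrite q0.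
Qed.

Definition eulerA (x : C) : C := limn (fun N => \sum_(n < N) (qfact q n)^-1 * x ^+ n).

Lemma weighted_euler_cvg (x : C) m : nc x < 1 -> exists l : C,
  (fun N => \sum_(n < N) n%:R ^+ m * ((qfact q n)^-1 * x ^+ n)) @ \oo --> l.
Proof.
move=> x1; have [L L0 HL] := inv_qfact_bounded.
apply: (@complex_abs_cvg R (fun n => n%:R ^+ m * ((qfact q n)^-1 * x ^+ n))
  (fun n => L * (n%:R ^+ m * nc x ^+ n))
  (L * (m`!%:R / (1 - nc x) ^+ m.+1))).
- move=> n; rewrite !Normc.normcM !ncX nc_nat mulrCA ler_wpM2r ?HL//.
  by rewrite mulr_ge0 ?exprn_ge0 ?nc_ge0.
- by move=> N; rewrite -mulr_sumr ler_wpM2l// sum_pow_exp_le// nc_ge0.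
Qed.

Lemma eulerA_cvg (x : C) : nc x < 1 ->
  (fun N => \sum_(n < N) (qfact q n)^-1 * x ^+ n) @ \oo --> eulerA x.
Proof.
move=> /(@weighted_euler_cvg x 0)[l xl].
have xl' : (fun N => \sum_(n < N) (qfact q n)^-1 * x ^+ n) @ \oo --> l.
  by apply: eq_cvgn xl => N; apply: eq_bigr => i _; rewrite expr0 mul1r.
by rewrite /eulerA (cvg_lim _ xl').
Qed.

Lemma eulerA_shift (x : C) : nc x < 1 -> (1 - x) * eulerA x = eulerA (x * q).
Proof.
move=> x1.
have xq1 : nc (x * q) < 1.
  rewrite Normc.normcM; apply: le_lt_trans x1.
  by rewrite ler_piMr ?nc_ge0// ltW.
have [L L0 HL] := inv_qfact_bounded.
have H1 := eulerA_cvg xq1.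
have H2 : (fun N => (qfact q N)^-1 * (1 - q ^+ N) * x ^+ N) @ \oo --> (0 : C).
  apply/cvg_ncP.
  (* [L] bounds the inverse q-factorial and 2 bounds [1 - q^N]. *)
  have : (fun N => L * 2 * nc x ^+ N) @ \oo --> (L * 2 * 0 : R).
    by apply: seqMl; apply: cvg_expr; rewrite ger0_norm ?nc_ge0.
  rewrite mulr0; apply: squeeze_cvgr; last exact: cvg_cst.
  apply: nearW => N; rewrite nc_ge0/= subr0 !Normc.normcM ncX.
  rewrite ler_wpM2r ?exprn_ge0 ?nc_ge0// ler_pM ?nc_ge0//.
  apply: le_trans (ncD _ _) _; rewrite Normc.normc1 ncN ncX lerD2l.
  by rewrite exprn_ile1 ?nc_ge0// ltW.
have H3 := seqB H1 H2; rewrite subr0 in H3.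
apply: seq_unique H3; apply: eq_cvgn (seqMl (b := 1 - x) (eulerA_cvg x1)) => N.
by rewrite sum_euler_shift// => n; exact: one_sub_qexp_neq0.
Qed.

Lemma nc_mul_qexp (x : C) N : nc x < 1 -> nc (x * q ^+ N) < 1.
Proof.
move=> x1; rewrite Normc.normcM ncX; apply: le_lt_trans x1.
by rewrite ler_piMr ?nc_ge0// exprn_ile1 ?nc_ge0// ltW.
Qed.

Lemma eulerA_prod (x : C) N : nc x < 1 ->
  \prod_(j < N) (1 - x * q ^+ j) * eulerA x = eulerA (x * q ^+ N).
Proof.
move=> x1; elim: N => [|N IH]; first by rewrite big_ord0 mul1r expr0 mulr1.
rewrite big_ord_recr/= mulrAC IH exprSr mulrA -eulerA_shift; first exact: mulrC.
exact: nc_mul_qexp.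
Qed.

(** The constant term is 1 and the other terms share a factor [x]. The auxiliary [y] keeps the
    constant fixed while [x] runs through the points [x q^N]. *)
Lemma eulerA_sub1 (x y : C) L : nc y < 1 -> nc x <= nc y ->
  (forall n, nc (qfact q n)^-1 <= L) ->
  nc (eulerA x - 1) <= nc x * (L / (1 - nc y)).
Proof.
move=> y1 xy HL; have x1 := le_lt_trans xy y1.
have L0 : 0 <= L by apply: le_trans (HL 0%N); exact: nc_ge0.
have H : (fun N => \sum_(n < N.+1) (qfact q n)^-1 * x ^+ n - 1) @ \oo --> eulerA x - 1.
  apply: seqB; last exact: cvg_cst.
  have := eulerA_cvg x1; rewrite -(cvg_shiftn 1); apply: eq_cvgn => N.
  by rewrite /= addn1.
apply: (nc_lim_le H) => N.
rewrite big_ord_recl/= {1}/qfact big_ord0 invr1 mulr1 addrAC subrr add0r.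
apply: le_trans (nc_sum _ _ _) _.
apply: (@le_trans _ _ (nc x * (L * \sum_(i < N) nc y ^+ i))).
  rewrite !mulr_sumr; apply: ler_sum => i _.
  rewrite /bump/= add1n Normc.normcM ncX exprS mulrCA ler_wpM2l ?nc_ge0//.
  by rewrite ler_pM ?exprn_ge0 ?nc_ge0// lerXn2r ?nnegrE ?nc_ge0.
by rewrite !ler_wpM2l ?nc_ge0// sum_exp_le// nc_ge0.
Qed.

Lemma cvg_eulerA_qexp (x : C) : nc x < 1 -> (fun N => eulerA (x * q ^+ N)) @ \oo --> (1 : C).
Proof.
move=> x1; have [L L0 HL] := inv_qfact_bounded.
apply/cvg_ncP.
have : (fun N => nc x * (L / (1 - nc x)) * nc q ^+ N) @ \oo -->
    (nc x * (L / (1 - nc x)) * 0 : R).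
  by apply: seqMl; apply: cvg_expr; rewrite ger0_norm ?nc_ge0.
rewrite mulr0; apply: squeeze_cvgr; last exact: cvg_cst.
apply: nearW => N; rewrite nc_ge0/=.
have le1 : nc (x * q ^+ N) <= nc x.
  by rewrite Normc.normcM ncX ler_piMr ?nc_ge0// exprn_ile1 ?nc_ge0// ltW.
apply: le_trans (eulerA_sub1 x1 le1 HL) _.
by rewrite Normc.normcM ncX [leRHS]mulrAC.
Qed.

(** A zero at [x] would propagate to every [x q^N] by the product formula, although the values there
    tend to 1. *)
Lemma eulerA_neq0 (x : C) : nc x < 1 -> eulerA x != 0.
Proof.
move=> x1; apply/eqP => A0; have /eqP := oner_neq0 C; apply.
apply: seq_unique (cvg_eulerA_qexp x1) _.
apply: eq_cvgn (cvg_cst (0 : C)) => N /=.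
by rewrite -eulerA_prod// A0 mulr0.
Qed.

(** Euler's identity: the finite product equals [A(x q^N)/A(x)], whose numerator tends to 1. *)
Lemma qpoch_cvg (x : C) : nc x < 1 ->
  (fun N => \prod_(j < N) (1 - x * q ^+ j)) @ \oo --> (eulerA x)^-1.
Proof.
move=> x1; have := seqMr (b := (eulerA x)^-1) (cvg_eulerA_qexp x1).
rewrite mul1r; apply: eq_cvgn => N.
by rewrite -eulerA_prod// mulfK// eulerA_neq0.
Qed.

Lemma qpochE (x : C) : nc x < 1 -> qpoch x q = (eulerA x)^-1.
Proof. by move=> /qpoch_cvg xl; rewrite /qpoch (cvg_lim _ xl). Qed.

(** Removing the first [n] factors of [(q;q)_oo] divides it by [(q;q)_n]. *)
Lemma qpoch_shift n : qpoch (q ^+ n.+1) q = qpoch q q * (qfact q n)^-1.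
Proof.
have qn1 : nc (q ^+ n.+1) < 1 by rewrite ncX exprn_ilt1 ?nc_ge0.
have H1 := qpoch_cvg qn1; have := qpoch_cvg hq.
rewrite -(cvg_shiftn n) => H2; rewrite !qpochE//.
apply: seq_unique H1 _; apply: eq_cvgn (seqMr (b := (qfact q n)^-1) H2) => N /=.
rewrite addnC big_split_ord/= mulrAC.
have -> : \prod_(i < n) (1 - q * q ^+ i) = qfact q n.
  by apply: eq_bigr => i _; rewrite exprS.
rewrite divff ?mul1r.
  by apply: eq_bigr => i _; rewrite exprD exprS mulrA.
by rewrite prodf_seq_neq0; apply/allP => i _; rewrite one_sub_qexp_neq0.
Qed.

End Euler.

(** * Lambert series *)

Section DivisorSums.
Variable F : fieldType.
Implicit Types (q : F) (G : nat -> F).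

Lemma sum_divisors_exp G q N :
  \sum_(1 <= n < N) (\sum_(d <- divisors n) G d) * q ^+ n =
  \sum_(1 <= d < N) G d * \sum_(1 <= n < N | (d %| n)%N) q ^+ n.
Proof.
under [RHS]eq_bigr do rewrite mulr_sumr.
rewrite (exchange_big_dep_nat xpredT)//=; apply: eq_big_nat => n /andP[n0 nN].
rewrite mulr_suml -[RHS]big_filter; apply: perm_big; apply: uniq_perm.
- exact: divisors_uniq.
- by rewrite filter_uniq// iota_uniq.
move=> d; rewrite mem_filter mem_index_iota -dvdn_divisors//.
case dn : (d %| n)%N => //=; apply/esym/andP; split; first exact: dvdn_gt0 dn.
exact: leq_ltn_trans (dvdn_leq n0 dn) nN.
Qed.

(** The multiples of [d] up to [N] give a geometric progression with [N %/ d] terms. *)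
Lemma sum_multiples_exp q d N : (0 < d)%N ->
  (1 - q ^+ d) * \sum_(1 <= n < N.+1 | (d %| n)%N) q ^+ n =
  q ^+ d - q ^+ (d * (N %/ d).+1).
Proof.
move=> d0; elim: N => [|N IH].
  by rewrite div0n muln1 subrr big_geq ?mulr0.
rewrite big_mkcond big_nat_recr//= -big_mkcond/= mulrDr IH divnS//.
case: ifP => [/dvdnP[j Nj]|_]; last by rewrite mulr0 addr0 add0n.
rewrite add1n.
have -> : (N %/ d).+1 = j.
  by have := divnS N d0; rewrite Nj mulnK// dvdn_mull// add1n.
by rewrite Nj (mulnC j) mulnS exprD; ring.
Qed.
End DivisorSums.

Section Lambert.
Variable R : realType.
Local Notation C := ((R[i])^o).
Local Notation nc := (@Normc.normc R).
Variables q c : C.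
Hypotheses (hq : nc q < 1) (hcq : nc (c * q) < 1).

(* As 0^-1 = 0, the term d = 0 is zero. *)
Definition lambert_term k d : C := d%:R ^+ k * ((1 - q ^+ d)^-1 * (c * q) ^+ d).

Lemma nc_lambert_term k d :
  nc (lambert_term k d) <= (1 - nc q)^-1 * (d%:R ^+ k * nc (c * q) ^+ d).
Proof.
have q1 : 0 < 1 - nc q by rewrite subr_gt0.
rewrite /lambert_term; move: (c * q) => x.
rewrite !Normc.normcM !ncX nc_nat mulrCA ler_wpM2r ?mulr_ge0 ?exprn_ge0 ?nc_ge0//.
case: d => [|d]; last exact: nc_inv_1B_qexp.
by rewrite expr0 subrr invr0 Normc.normc0 invr_ge0 ltW.
Qed.

Lemma sum_nc_lambert_term_le k N :
  \sum_(d < N) (1 - nc q)^-1 * (d%:R ^+ k * nc (c * q) ^+ d) <=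
  (1 - nc q)^-1 * (k`!%:R / (1 - nc (c * q)) ^+ k.+1).
Proof.
have q1 : 0 < 1 - nc q by rewrite subr_gt0.
by rewrite -mulr_sumr ler_wpM2l ?invr_ge0 ?(ltW q1)// sum_pow_exp_le// nc_ge0.
Qed.

(** Grouping by the divisor [d] leaves a geometric sum over its multiples. The subtracted term is
    the tail of that progression, from the first multiple of [d] exceeding [N.-1]. *)
Lemma sum_sigmac k N :
  \sum_(1 <= n < N) sigmac k c n * q ^+ n =
  \sum_(d < N) (lambert_term k d -
     d%:R ^+ k * c ^+ d * (1 - q ^+ d)^-1 * q ^+ (d * (N.-1 %/ d).+1)).
Proof.
rewrite /sigmac (sum_divisors_exp (fun d => d%:R ^+ k * c ^+ d)).
case: N => [|N]; first by rewrite big_geq// big_ord0.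
rewrite big_add1 /= big_mkord [RHS]big_ord_recl/= /lambert_term.
rewrite expr0 subrr invr0 !(mulr0, mul0r) subrr add0r.
apply: eq_bigr => i _; rewrite /bump/= add1n.
have d0 := one_sub_qexp_neq0 hq i.
rewrite -[X in _ * X](mulKf d0) sum_multiples_exp// exprMn.
by rewrite !mulrBr; congr (_ - _); rewrite -!mulrA; congr (_ * _); rewrite mulrCA.
Qed.

Lemma lambert_cvg k :
  (fun N => \sum_(d < N) lambert_term k d) @ \oo --> Kc q c k.+1.
Proof.
have [l Hl] := complex_abs_cvg (nc_lambert_term k) (sum_nc_lambert_term_le k).
pose e N d : C := d%:R ^+ k * c ^+ d * (1 - q ^+ d)^-1 * q ^+ (d * (N.-1 %/ d).+1).
have := @tannery R (fun N d => lambert_term k d - e N d) (lambert_term k)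
  (fun d => (1 - nc q)^-1 * (d%:R ^+ k * nc (c * q) ^+ d)) _ _ (sum_nc_lambert_term_le k).
move=> /(_ _ _)/wrap[].
- move=> N d; rewrite addrAC subrr add0r ncN.
  (* The error is a Lambert term times a power of [q], so the Lambert majorant dominates it as
     well. *)
  have -> : e N d = lambert_term k d * q ^+ (d * (N.-1 %/ d)).
    rewrite /e /lambert_term mulnS exprD exprMn -!mulrA; congr (_ * _).
    exact: mulrCA.
  rewrite Normc.normcM; apply: le_trans (nc_lambert_term k d).
  by rewrite ler_piMr ?nc_ge0// ncX exprn_ile1 ?nc_ge0// ltW.
- move=> d; rewrite -[X in _ --> X]subr0; apply: seqB; first exact: cvg_cst.
  apply/cvg_ncP; pose D := nc (d%:R ^+ k * c ^+ d * (1 - q ^+ d)^-1).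
  case: d @D => [|d] D.
    apply: eq_cvgn (cvg_cst (0 : R)) => N.
    by rewrite /e expr0 subrr invr0 mulr0 mul0r subr0 Normc.normc0.
  have : (fun N => D * nc q ^+ N) @ \oo --> (D * 0 : R).
    by apply: seqMl; apply: cvg_expr; rewrite ger0_norm ?nc_ge0.
  rewrite mulr0; apply: squeeze_cvgr; last exact: cvg_cst.
  apply: nearW => N; rewrite nc_ge0/= subr0 /e Normc.normcM ler_wpM2l ?nc_ge0// ncX.
  (* The first multiple of [d] beyond [N.-1] is at least [N], so the error decays like
     [nc q ^+ N]. *)
  rewrite ler_wiXn2l ?nc_ge0// ?(ltW hq)//.
  by case: N => [//|N]; rewrite mulnC ltn_ceil.
move=> /(fun h => seqD h Hl); rewrite add0r => H.
suff : (fun N => \sum_(1 <= n < N) sigmac k c n * q ^+ n) @ \oo --> l.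
  by move=> H'; rewrite /Kc/= (cvg_lim _ H').
by apply: eq_cvgn H => N; rewrite sum_sigmac subrK.
Qed.

(** This growth rate gives the series of [K_m t^m/m!] a positive radius of convergence. *)
Lemma nc_Kc_le k :
  nc (Kc q c k.+1) <= (1 - nc q)^-1 * (k`!%:R / (1 - nc (c * q)) ^+ k.+1).
Proof.
apply: (nc_lim_le (@lambert_cvg k)) => N.
apply: le_trans (nc_sum _ _ _) (le_trans _ (sum_nc_lambert_term_le k N)).
by apply: ler_sum => d _; exact: nc_lambert_term.
Qed.

End Lambert.

(** * The moment recurrence *)

Section Moments.
Variable F : fieldType.
Variables (q x : F).
Hypothesis hq : forall n, 1 - q ^+ n.+1 != 0.

Lemma weighted_newton m n :
  n%:R ^+ m.+1 * ((qfact q n)^-1 * x ^+ n) =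
  \sum_(k < m.+1) 'C(m, k)%:R * \sum_(d < n.+1)
    (d%:R ^+ k * ((1 - q ^+ d)^-1 * x ^+ d)) *
    ((n - d)%:R ^+ (m - k) * ((qfact q (n - d))^-1 * x ^+ (n - d))).
Proof.
(* One factor [n] is consumed by Newton's identity; the remaining [n^m] is expanded binomially from
   [n = (n - d) + d]. *)
rewrite exprSr -mulrA [n%:R * _]mulrA qfact_newton// mulr_suml mulr_sumr.
under [RHS]eq_bigr do rewrite mulr_sumr.
rewrite [RHS]exchange_big/=; apply: eq_bigr => d _.
have dn : (d <= n)%N by rewrite -ltnS.
have nE : n%:R = (n - d)%:R + d%:R :> F by rewrite -natrD subnK.
have xE : x ^+ n = x ^+ d * x ^+ (n - d) by rewrite -exprD subnKC.
rewrite nE xE exprDn mulr_suml; apply: eq_bigr => k _.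
rewrite -mulr_natl.
move: (d%:R ^+ k) ((n - d)%:R ^+ _) ((1 - q ^+ d)^-1) ((qfact q _)^-1) => a b e f.
by move: (x ^+ d) (x ^+ (n - d)) ('C(m, k)%:R) => y z g; ring.
Qed.

(** In this and the next facts [z] stands for the moment of order 0, [s] for a successor, [b] for a
    binomial coefficient, and [f], [a], [d] for factorials. *)
Fact cancel_succ (s M z f : F) : s != 0 -> z != 0 -> f != 0 ->
  s * (M / (z * (s * f))) = M / (z * f).
Proof. by move=> s0 z0 f0; field; rewrite s0 z0 f0. Qed.

Fact cancel_bin (b K Z z a d : F) : b != 0 -> z != 0 -> a != 0 -> d != 0 ->
  b * (K * Z) / (z * (b * (a * d))) = K / a * (Z / (z * d)).
Proof. by move=> b0 z0 a0 d0; field; rewrite b0 z0 a0 d0. Qed.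

Fact cancel_moment (M z f : F) : z != 0 -> f != 0 -> M = z * (f * (M / (z * f))).
Proof. by move=> z0 f0; field; rewrite z0 f0. Qed.

Fact cancel_fact (s K h t1 t2 f : F) : s != 0 -> f != 0 ->
  K / f * h * (t1 * t2) = s * (K * t1 / (s * f)) * (h * t2).
Proof. by move=> s0 f0; field; rewrite s0 f0. Qed.

Fact cancel_weight (p h t f : F) : f != 0 -> p * (h * t) = p * (f * h) * t / f.
Proof. by move=> f0; field. Qed.
End Moments.

Section MomentSeries.
Variable R : realType.
Local Notation C := ((R[i])^o).
Local Notation nc := (@Normc.normc R).
Variables q c : C.
Hypotheses (hq : nc q < 1) (hcq : nc (c * q) < 1).

(** As [0 ^+ 0 = 1], the term [n = 0] contributes 1 to the moment of order 0 and nothing to the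
    others. *)
Definition moment_term m n : C := n%:R ^+ m * ((qfact q n)^-1 * (c * q) ^+ n).
Definition moment m : C := limn (fun N => \sum_(n < N) moment_term m n).

Lemma moment_cvg m : (fun N => \sum_(n < N) moment_term m n) @ \oo --> moment m.
Proof.
have [l Hl] := weighted_euler_cvg hq m hcq.
by rewrite /moment (cvg_lim _ Hl).
Qed.

Lemma moment0 : moment 0 = eulerA q (c * q).
Proof.
apply: seq_unique (@moment_cvg 0) _; apply: eq_cvgn (eulerA_cvg hq hcq) => N.
by apply: eq_bigr => n _; rewrite /moment_term expr0 mul1r.
Qed.

Lemma nc_sum_moment_term_bounded m :
  exists B : R, forall N, nc (\sum_(n < N) moment_term m n) <= B.
Proof.
have [L L0 HL] := inv_qfact_bounded hq.
exists (L * (m`!%:R / (1 - nc (c * q)) ^+ m.+1)) => N.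
have := @sum_pow_exp_le R (nc (c * q)) m N; rewrite nc_ge0 => /(_ hcq) H.
apply: le_trans (ler_wpM2l L0 H); apply: le_trans (nc_sum _ _ _) _.
rewrite mulr_sumr; apply: ler_sum => n _; rewrite /moment_term; move: (c * q) => x.
rewrite !Normc.normcM !ncX nc_nat mulrCA ler_wpM2r ?HL//.
by rewrite mulr_ge0 ?exprn_ge0 ?nc_ge0.
Qed.

(** By [weighted_newton] the partial sums are combinations of Cauchy products of Lambert and moment
    series, whose limits Mertens' theorem gives. *)
Lemma momentS m :
  moment m.+1 = \sum_(k < m.+1) 'C(m, k)%:R * (Kc q c k.+1 * moment (m - k)).
Proof.
apply: seq_unique (@moment_cvg m.+1) _.
have H (k : nat) : (fun N => 'C(m, k)%:R * \sum_(n < N) \sum_(d < n.+1)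
    lambert_term q c k d * moment_term (m - k) (n - d)) @ \oo -->
    ('C(m, k)%:R * (Kc q c k.+1 * moment (m - k)) : C).
  have [B HB] := nc_sum_moment_term_bounded (m - k).
  apply: seqMl; exact: (mertens (nc_lambert_term c hq k)
    (sum_nc_lambert_term_le hq hcq k) HB (lambert_cvg hq hcq (k := k))
    (@moment_cvg (m - k)%N)).
have := @seq_sum _ m.+1 (fun k N => 'C(m, k)%:R * \sum_(n < N) \sum_(d < n.+1)
    lambert_term q c k d * moment_term (m - k) (n - d)) _ (fun k _ => H k).
apply: eq_cvgn => N; under eq_bigr do rewrite mulr_sumr.
rewrite exchange_big/=; apply: eq_bigr => n _.
by rewrite /moment_term weighted_newton// => j; exact: one_sub_qexp_neq0.
Qed.

Lemma moment0_neq0 : moment 0 != 0.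
Proof. by rewrite moment0 eulerA_neq0. Qed.

(** These turn out to be the Taylor coefficients of [exp(sum_m K_m t^m/m!)]. *)
Definition normalized_moment m : C := moment m / (moment 0 * m`!%:R).

Lemma normalized_moment0 : normalized_moment 0 = 1.
Proof. by rewrite /normalized_moment mulr1 divff// moment0_neq0. Qed.

Lemma normalized_momentS j :
  j.+1%:R * normalized_moment j.+1 =
  \sum_(i < j.+1) Kc q c i.+1 / i`!%:R * normalized_moment (j - i).
Proof.
have fn0 n : n`!%:R != 0 :> C by rewrite pnatr_eq0 -lt0n fact_gt0.
have Sn0 : j.+1%:R != 0 :> C by rewrite pnatr_eq0.
have -> : j.+1%:R * normalized_moment j.+1 = moment j.+1 / (moment 0 * j`!%:R).
  by rewrite /normalized_moment factS natrM; apply: cancel_succ; rewrite ?moment0_neq0.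
rewrite momentS mulr_suml; apply: eq_bigr => i _.
have ij : (i <= j)%N by rewrite -ltnS.
rewrite /normalized_moment -(bin_fact ij) !natrM; apply: cancel_bin; rewrite ?moment0_neq0//.
by rewrite pnatr_eq0 -lt0n bin_gt0.
Qed.

(** [Mc] starts at [n = 1]; for positive [m] the term [n = 0] of the moment vanishes, so the two
    sums match. *)
Lemma McE m : (0 < m)%N -> Mc q c m = qpoch q q * moment m.
Proof.
move=> m0; have H := seqMl (b := qpoch q q) (@moment_cvg m).
suff H' : (fun N => \sum_(1 <= n < N)
    (n%:R ^+ m * c ^+ n * q ^+ n * qpoch (q ^+ n.+1) q)) @ \oo --> qpoch q q * moment m by rewrite /Mc (cvg_lim _ H').
apply: eq_cvgn H => -[|N]; first by rewrite big_geq// big_ord0 mulr0.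
rewrite big_ord_recl /moment_term -{1}(prednK m0) exprS !mul0r add0r.
rewrite big_add1/= big_mkord mulr_sumr; apply: eq_bigr => n _.
rewrite /bump/= add1n qpoch_shift//.
rewrite exprMn; move: (qpoch q q) (n.+1%:R ^+ m) (c ^+ _) (q ^+ _) ((qfact _ _)^-1) => Q a b d e.
by rewrite mulrCA [e * _]mulrC [Q * (_ * e)]mulrCA !mulrA.
Qed.

Lemma qpoch_ratioE : qpoch q q / qpoch (c * q) q = qpoch q q * moment 0.
Proof. by rewrite [qpoch (c * q) q]qpochE// invrK moment0. Qed.
End MomentSeries.

(** * Bell polynomials *)

Section Bell.
Variable K : numFieldType.

(** A truncation of [exp(v X^i)]; polynomials modulo a power of [X] replace formal power series. *)
Definition exp_poly (v : K) (i N : nat) : {poly K} :=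
  \sum_(k < N.+1) (v ^+ k / k`!%:R) *: 'X^(i * k).

Lemma deriv_exp_poly v i N : exists r : {poly K},
  (exp_poly v i.+1 N)^`() = (i.+1%:R * v) *: 'X^i * exp_poly v i.+1 N + 'X^N * r.
Proof.
(* Only the last term of the truncation violates the differential equation; its degree [i + (i+1)N]
   is at least [N]. *)
exists (- ((i.+1%:R * v * (v ^+ N / N`!%:R)) *: 'X^(i + i * N))).
rewrite /exp_poly raddf_sum/= big_ord_recl/= muln0 derivZ derivXn mulr0n scaler0 add0r.
rewrite [in RHS]big_ord_recr/= mulrDr mulrN -!addrA.
have -> : (i.+1%:R * v) *: 'X^i * ((v ^+ N / N`!%:R) *: 'X^(i.+1 * N)) =
   'X^N * ((i.+1%:R * v * (v ^+ N / N`!%:R)) *: 'X^(i + i * N)) :> {poly K}.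
  rewrite -scalerAl -[in LHS]scalerAr -[in RHS]scalerAr scalerA -!exprD; congr (_ *: 'X^_).
  by rewrite mulSn addnCA.
rewrite subrr addr0 mulr_sumr; apply: eq_bigr => k _.
rewrite /bump/= add1n derivZ derivXn.
rewrite -[RHS]scalerAl -scalerAr -exprD [RHS]scalerA -[_ *+ (_ * _)]scaler_nat [LHS]scalerA.
rewrite mulnS addSn/=; congr (_ *: 'X^_).
rewrite factS natrM exprS -addSn -mulnS natrM.
by field; rewrite nat1r !pnatr_eq0 -lt0n fact_gt0.
Qed.

Lemma deriv_prod_exp_poly (v : nat -> K) n N : exists r : {poly K},
  (\prod_(i < n) exp_poly (v i.+1) i.+1 N)^`() =
  (\sum_(i < n) (i.+1%:R * v i.+1) *: 'X^i) * \prod_(i < n) exp_poly (v i.+1) i.+1 N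
  + 'X^N * r.
Proof.
elim: n => [|n [r IH]].
  by exists 0; rewrite !big_ord0 derivC mul0r mulr0 addr0.
have [s Hs] := deriv_exp_poly (v n.+1) n N.
exists (r * exp_poly (v n.+1) n.+1 N + \prod_(i < n) exp_poly (v i.+1) i.+1 N * s).
by rewrite big_ord_recr/= derivM IH Hs big_ord_recr/=; ring.
Qed.

(* The truncated product [\prod_i exp (v_i X^i)] is a generating function: its
   logarithmic derivative gives the recurrence modulo ['X^m]. *)
Lemma coef_prod_exp_poly (v h : nat -> K) m :
  h 0%N = 1 ->
  (forall j, j.+1%:R * h j.+1 = \sum_(i < j.+1) i.+1%:R * v i.+1 * h (j - i)%N) ->
  forall j, (j <= m)%N -> (\prod_(i < m) exp_poly (v i.+1) i.+1 m)`_j = h j.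
Proof.
move=> h0 hS j; elim/ltn_ind: j => -[_ _|j IH jm].
  rewrite -horner_coef0 horner_prod h0 big1// => i _.
  rewrite horner_sum big_ord_recl/= muln0 big1 => [|k _]; last first.
    by rewrite /bump/= add1n hornerZ mulnS addSn hornerXn expr0n/= mulr0.
  by rewrite hornerZ hornerXn expr0 divr1 mulr1 addr0.
apply: (mulfI (x := j.+1%:R)); first by rewrite pnatr_eq0.
rewrite hS; have [r Hr] := deriv_prod_exp_poly v m m.
move/(congr1 (fun p : {poly K} => p`_j)): Hr.
rewrite coef_deriv mulr_natl => ->.
(* Since [j < m], the remainder divisible by [X^m] does not reach degree [j]. *)
rewrite coefD coefXnM jm addr0 mulr_suml coef_sum.
rewrite [in RHS](big_ord_widen_cond m xpredT (fun i => i.+1%:R * v i.+1 * h (j - i)%N))//=.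
rewrite [RHS]big_mkcond/=; apply: eq_bigr => i _.
rewrite -scalerAl coefZ coefXnM ltnS ltnNge; case: leqP => ij /=; last by rewrite mulr0.
by rewrite IH// ?ltnS ?leq_subr// (leq_trans (leq_subr _ _))// ltnW.
Qed.

(** Expanding the product chooses an exponent [k i] in each factor, and extracting degree [m]
    imposes the weight condition on [k]. *)
Lemma coef_prod_exp_polyE (v : nat -> K) m N :
  (\prod_(i < m) exp_poly (v i.+1) i.+1 N)`_m =
  \sum_(k : {ffun 'I_m -> 'I_N.+1} | (\sum_(i < m) i.+1 * k i)%N == m)
    \prod_(i < m) (v i.+1 ^+ k i / (k i)`!%:R).
Proof.
rewrite /exp_poly bigA_distr_bigA/= coef_sum [RHS]big_mkcond/=.
apply: eq_bigr => k _.
rewrite scaler_prod coefZ.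
have -> : \prod_(i < m) ('X^(i.+1 * k i) : {poly K}) = 'X^(\sum_(i < m) i.+1 * k i).
  by rewrite -prodrXr.
by rewrite coefXn eq_sym; case: eqP => _; rewrite ?mulr0 ?mulr1.
Qed.
End Bell.

(** The coefficient of [X^m] in the truncated product of the [exp(u_i X^i/i!)] is computed twice: by
    expansion it is the Bell sum over [m!], by the logarithmic derivative it is [h m]. *)
Lemma bellY_rec (R : realType) (u h : nat -> (R[i])^o) (m : nat) :
  h 0%N = 1 ->
  (forall j, j.+1%:R * h j.+1 = \sum_(i < j.+1) u i.+1 / i`!%:R * h (j - i)%N) ->
  bellY m u = m`!%:R * h m.
Proof.
move=> h0 hS.
pose v i := u i / i`!%:R.
have hv (j : nat) : j.+1%:R * h j.+1 = \sum_(i < j.+1) i.+1%:R * v i.+1 * h (j - i)%N.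
  rewrite hS; apply: eq_bigr => i _; congr (_ * _).
  by rewrite /v factS natrM; field; rewrite nat1r !pnatr_eq0 -lt0n fact_gt0.
have := @coef_prod_exp_poly R[i] v h m h0 hv m (leqnn m).
rewrite coef_prod_exp_polyE => <-; rewrite mulr_sumr /bellY.
apply: eq_bigr => k _.
by rewrite big_split/= prodfV -natr_prod mulrA mulrAC.
Qed.

(** * Exponential of a power series *)

Section ConvPower.
Variable K : numFieldType.
Implicit Types w h : nat -> K.

(** The coefficients of the [k]-th power of the formal series with coefficients [w]. *)
Fixpoint conv_pow w k j : K :=
  if k is k'.+1 then \sum_(i < j.+1) w i * conv_pow w k' (j - i)%N else (j == 0)%:R.

Arguments conv_pow : simpl never.

Lemma conv_powS w k j :
  conv_pow w k.+1 j = \sum_(i < j.+1) w i * conv_pow w k (j - i)%N.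
Proof. by []. Qed.

Lemma conv_pow_coef w k j N : (j < N)%N ->
  conv_pow w k j = ((\poly_(i < N) w i) ^+ k)`_j.
Proof.
elim: k j => [|k IH] j jN; first by rewrite expr0 coef1 /conv_pow.
rewrite conv_powS exprS coefM; apply: eq_bigr => i _.
rewrite coef_poly (leq_trans (ltn_ord i) jN).
congr (_ * _). apply: IH; exact: leq_ltn_trans (leq_subr _ _) jN.
Qed.

(** This is the coefficient of [X^j] in [(W^(k+1))' = (k+1) W' W^k], computed on a polynomial
    truncation of [W]. *)
Lemma conv_pow_deriv w k j :
  j.+1%:R * conv_pow w k.+1 j.+1 =
  k.+1%:R * \sum_(i < j.+1) i.+1%:R * w i.+1 * conv_pow w k (j - i)%N.
Proof.
rewrite (@conv_pow_coef _ _ _ j.+2)// mulr_natl -coef_deriv deriv_exp/=.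
rewrite coefMn mulr_natl; congr (_ *+ _).
rewrite coefM; apply: eq_bigr => i _.
rewrite coef_deriv coef_poly ltnS ltn_ord mulr_natl.
by rewrite -conv_pow_coef// ltnS (leq_trans (leq_subr _ _)).
Qed.

Lemma conv_pow_small w k j : w 0%N = 0 -> (j < k)%N -> conv_pow w k j = 0.
Proof.
move=> w0; elim: k j => [//|k IH] j jk; rewrite conv_powS big1// => i _.
case: i => -[|i] ij /=; first by rewrite w0 mul0r.
by rewrite IH ?mulr0//; case: j jk ij => [//|j] jk ij; rewrite subSS (leq_ltn_trans (leq_subr _ _)).
Qed.

Lemma sum_conv_pow_fact w j N : w 0%N = 0 -> (j < N)%N ->
  \sum_(k < N) conv_pow w k j / k`!%:R = \sum_(k < j.+1) conv_pow w k j / k`!%:R.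
Proof.
move=> w0 jN; rewrite -(subnKC jN) big_split_ord/= [X in _ + X]big1 ?addr0// => i _.
by rewrite conv_pow_small ?mul0r// ltnS leq_addr.
Qed.

(** The recurrence says [H' = W' H] with [H(0) = 1], which [exp W] also satisfies. Each coefficient
    of [exp W] is a finite sum because [W^k] has no term below degree [k]. *)
Lemma conv_pow_exp w h : w 0%N = 0 -> h 0%N = 1 ->
  (forall j, j.+1%:R * h j.+1 = \sum_(i < j.+1) i.+1%:R * w i.+1 * h (j - i)%N) ->
  forall j, h j = \sum_(k < j.+1) conv_pow w k j / k`!%:R.
Proof.
move=> w0 h0 hS; elim/ltn_ind => -[_|j IH].
  by rewrite big_ord1 /= h0 divr1.
apply: (mulfI (x := j.+1%:R)); first by rewrite pnatr_eq0.
rewrite hS [in RHS]big_ord_recl/= mul0r add0r mulr_sumr.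
have term k : j.+1%:R * (conv_pow w k.+1 j.+1 / k.+1`!%:R) =
    \sum_(i < j.+1) i.+1%:R * w i.+1 * (conv_pow w k (j - i)%N / k`!%:R).
  rewrite mulrA conv_pow_deriv factS natrM invfM mulrACA divff ?pnatr_eq0// mul1r.
  by rewrite mulr_suml; apply: eq_bigr => i _; rewrite mulrA.
under [RHS]eq_bigr => k _ do rewrite /bump/= add1n term.
rewrite exchange_big/=; apply: eq_bigr => i _.
rewrite -mulr_sumr sum_conv_pow_fact ?ltnS ?leq_subr// -IH//.
by rewrite ltnS leq_subr.
Qed.
End ConvPower.

Section ExpSeries.
Variable R : realType.
Local Notation C := ((R[i])^o).
Local Notation nc := (@Normc.normc R).

Lemma cexp_cvg (z : C) :
  (fun N => \sum_(k < N) z ^+ k / k`!%:R) @ \oo --> cexp z.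
Proof.
have [l Hl] := @complex_abs_cvg R (fun k => z ^+ k / k`!%:R)
  (fun k => nc z ^+ k / k`!%:R) (expR (nc z))
  (fun k => ltac:(rewrite Normc.normcM Normc.normcV ncX nc_nat//))
  (fun N => sum_exp_coeff_le N (nc_ge0 z)).
suff : (fun N => \sum_(0 <= k < N) z ^+ k / k`!%:R) @ \oo --> l.
  by move=> H; rewrite /cexp (cvg_lim _ H).
by apply: eq_cvgn Hl => N; rewrite big_mkord.
Qed.

(** Weakening the ratio from 1/4 to 1/2 absorbs the convolution: since [w 0 = 0], each step costs
    only the sum of [2^-i] over [i >= 1], at most 1. *)
Lemma nc_conv_pow_le (w : nat -> C) (M : R) k j : w 0%N = 0 ->
  (forall i, nc (w i) <= M * 4^-1 ^+ i) -> nc (conv_pow w k j) <= M ^+ k * 2^-1 ^+ j.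
Proof.
move=> w0 wM.
have M0 : 0 <= M by have := wM 0%N; rewrite w0 Normc.normc0 expr0 mulr1.
elim: k j => [|k IH] j.
  rewrite expr0 mul1r /= nc_nat; case: j => [|j]; first by rewrite expr0.
  by rewrite exprn_ge0// invr_ge0.
rewrite conv_powS big_ord_recl/= w0 mul0r add0r.
apply: le_trans (nc_sum _ _ _) _.
apply: (@le_trans _ _ (\sum_(i < j) M ^+ k.+1 * 2^-1 ^+ j * 2^-1 ^+ i.+1)).
  apply: ler_sum => i _; rewrite Normc.normcM /bump/= add1n.
  apply: le_trans (ler_pM (nc_ge0 _) (nc_ge0 _) (wM _) (IH _)) _.
  have ij : (i.+1 + (j - i.+1))%N = j by rewrite subnKC.
  have -> : (2^-1 : R) ^+ j = 2^-1 ^+ i.+1 * 2^-1 ^+ (j - i.+1) by rewrite -exprD ij.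
  rewrite (_ : 4^-1 = 2^-1 * 2^-1 :> R); last by field.
  rewrite exprMn [M ^+ _.+1]exprS le_eqVlt; apply/orP; left; apply/eqP.
  by move: (_ ^+ i.+1) (_ ^+ (j - i.+1)) (M ^+ k) => a b d; ring.
rewrite -mulr_sumr ler_piMr ?mulr_ge0 ?exprn_ge0// ?invr_ge0//.
under eq_bigr do rewrite exprS.
rewrite -mulr_sumr; apply: (@le_trans _ _ (2^-1 * (1 - 2^-1)^-1)).
  rewrite ler_wpM2l// sum_exp_le//; apply/andP; split; lra.
by rewrite le_eqVlt; apply/orP; left; apply/eqP; field.
Qed.

Lemma sum_half_le N : \sum_(j < N) (2^-1 : R) ^+ j <= 2.
Proof.
rewrite [leRHS](_ : _ = (1 - 2^-1)^-1); last by field.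
by apply: sum_exp_le; apply/andP; split; lra.
Qed.

Lemma nc_sum_conv_pow_le (w : nat -> C) (M : R) k N : w 0%N = 0 ->
  (forall i, nc (w i) <= M * 4^-1 ^+ i) ->
  nc (\sum_(j < N) conv_pow w k j) <= M ^+ k * 2.
Proof.
move=> w0 wM.
have M0 : 0 <= M by have := wM 0%N; rewrite w0 Normc.normc0 expr0 mulr1.
apply: le_trans (nc_sum _ _ _) _.
apply: (@le_trans _ _ (\sum_(j < N) M ^+ k * 2^-1 ^+ j)).
  by apply: ler_sum => j _; exact: nc_conv_pow_le.
by rewrite -mulr_sumr ler_wpM2l ?exprn_ge0// sum_half_le.
Qed.

Lemma sum_quarter_le (M : R) N : 0 <= M -> \sum_(j < N) M * 4^-1 ^+ j <= M * 2.
Proof.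
move=> M0; rewrite -mulr_sumr ler_wpM2l//; apply: le_trans (sum_half_le N).
by apply: ler_sum => j _; rewrite lerXn2r ?nnegrE//; lra.
Qed.

Lemma conv_pow_cvg (w : nat -> C) (M : R) (S : C) k : w 0%N = 0 ->
  (forall i, nc (w i) <= M * 4^-1 ^+ i) ->
  (fun N => \sum_(i < N) w i) @ \oo --> S ->
  (fun N => \sum_(j < N) conv_pow w k j) @ \oo --> S ^+ k.
Proof.
move=> w0 wM wS.
have M0 : 0 <= M by have := wM 0%N; rewrite w0 Normc.normc0 expr0 mulr1.
elim: k => [|k IH].
  rewrite expr0 -(cvg_shiftn 1); apply: eq_cvgn (cvg_cst (1 : C)) => N.
  by rewrite /= addn1 big_ord_recl/= big1 ?addr0.
rewrite exprS; apply: (mertens wM (fun N => sum_quarter_le N M0) _ wS IH) => N.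
exact: nc_sum_conv_pow_le.
Qed.

(** The sum of [h j] over [j < N] is the sum over [k < N] of the truncated series of [W^k/k!]. These
    tend to [S^k/k!] and are bounded by [2 M^k/k!], so Tannery's theorem applies in [k]. *)
Lemma exp_power_series (w h : nat -> C) (M : R) (S : C) :
  w 0%N = 0 -> (forall i, nc (w i) <= M * 4^-1 ^+ i) ->
  (fun N => \sum_(i < N) w i) @ \oo --> S -> h 0%N = 1 ->
  (forall j, j.+1%:R * h j.+1 = \sum_(i < j.+1) i.+1%:R * w i.+1 * h (j - i)%N) ->
  (fun N => \sum_(j < N) h j) @ \oo --> cexp S.
Proof.
move=> w0 wM wS h0 hS.
have M0 : 0 <= M by have := wM 0%N; rewrite w0 Normc.normc0 expr0 mulr1.
have hE := @conv_pow_exp R[i] w h w0 h0 hS.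
have H : (fun N => \sum_(k < N) (\sum_(j < N) conv_pow w k j) / k`!%:R
                 - \sum_(k < N) S ^+ k / k`!%:R) @ \oo --> (0 : C).
  apply: (@tannery R (fun N k => (\sum_(j < N) conv_pow w k j) / k`!%:R) (fun k => S ^+ k / k`!%:R)
    (fun k => 2 * (M ^+ k / k`!%:R) + nc S ^+ k / k`!%:R) (2 * expR M + expR (nc S))).
  - move=> N k; apply: le_trans (ncD _ _) _; rewrite ncN !Normc.normcM Normc.normcV nc_nat ncX.
    rewrite lerD2r mulrA ler_wpM2r ?invr_ge0// mulrC.
    exact: nc_sum_conv_pow_le.
  - move=> N; rewrite big_split/= -mulr_sumr lerD// ?sum_exp_coeff_le ?nc_ge0//.
    by rewrite ler_wpM2l// sum_exp_coeff_le.
  - by move=> k; apply: seqMr; exact: conv_pow_cvg wM wS.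
have := seqD H (@cexp_cvg S); rewrite add0r; apply: eq_cvgn => N.
rewrite subrK; under eq_bigr do rewrite mulr_suml.
rewrite exchange_big/=; apply: eq_bigr => j _.
by rewrite hE sum_conv_pow_fact.
Qed.
End ExpSeries.

(** * The generating function *)

Section GeneratingFunction.
Variable R : realType.
Local Notation C := ((R[i])^o).
Local Notation nc := (@Normc.normc R).
Variables q c : C.
Hypotheses (hq : nc q < 1) (hcq : nc (c * q) < 1).

(** The leading factor removes the index 0, where [Kc] takes the spurious value [Kc q c 1] because
    [0.-1 = 0]. *)
Definition Kc_term (t : C) i : C := (i != 0)%N%:R * (Kc q c i * t ^+ i / i`!%:R).

Lemma nc_Kc_term_le t i : nc t < (1 - nc (c * q)) / 4 ->
  nc (Kc_term t i) <= (1 - nc q)^-1 * 4^-1 ^+ i.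
Proof.
have q1 : 0 < 1 - nc q by rewrite subr_gt0.
have y1 : 0 < 1 - nc (c * q) by rewrite subr_gt0.
move=> /ltW; rewrite /Kc_term; case: i => [|i] ht.
  by rewrite mul0r Normc.normc0 expr0 mulr1 invr_ge0 ltW.
rewrite mul1r !Normc.normcM Normc.normcV ncX nc_nat.
have := nc_Kc_le hq hcq i; move: (1 - nc (c * q)) y1 ht => y y0 ht HK.
have f0 n : 0 < n`!%:R :> R by rewrite ltr0n fact_gt0.
rewrite ler_pdivrMr//.
apply: le_trans (ler_pM (nc_ge0 _) _ HK (lerXn2r i.+1 _ _ ht)) _;
  rewrite ?exprn_ge0 ?nnegrE ?nc_ge0// ?divr_ge0 ?(ltW y0)//.
rewrite exprMn -!mulrA ler_pM2l ?invr_gt0//.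
rewrite mulKf ?expf_neq0 ?gt_eqF// mulrC ler_wpM2l ?exprn_ge0 ?invr_ge0//.
by rewrite ler_nat factS leq_pmull.
Qed.

Lemma sum_Kc_term t N :
  \sum_(1 <= m < N) Kc q c m * t ^+ m / m`!%:R = \sum_(i < N) Kc_term t i.
Proof.
case: N => [|N]; first by rewrite big_geq// big_ord0.
rewrite big_add1/= big_mkord big_ord_recl /Kc_term mul0r add0r.
by apply: eq_bigr => i _; rewrite mul1r.
Qed.

Lemma sum_normalized_moment_cvg t S : nc t < (1 - nc (c * q)) / 4 ->
  (fun N => \sum_(i < N) Kc_term t i) @ \oo --> S ->
  (fun N => \sum_(j < N) normalized_moment q c j * t ^+ j) @ \oo --> cexp S.
Proof.
move=> ht HS.
apply: (exp_power_series (h := fun j => normalized_moment q c j * t ^+ j) _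
  (fun i => nc_Kc_term_le i ht) HS).
- by rewrite /Kc_term mul0r.
- by rewrite normalized_moment0// mul1r.
move=> j; rewrite mulrA normalized_momentS// mulr_suml; apply: eq_bigr => i _.
have ij : (i <= j)%N by rewrite -ltnS.
have -> : t ^+ j.+1 = t ^+ i.+1 * t ^+ (j - i) by rewrite -exprD addSn subnKC.
have f0 : i`!%:R != 0 :> C by rewrite pnatr_eq0 -lt0n fact_gt0.
have s0 : i.+1%:R != 0 :> C by rewrite pnatr_eq0.
by rewrite /Kc_term mul1r factS natrM; exact: cancel_fact.
Qed.
End GeneratingFunction.

Unset Implicit Arguments.

Theorem theorem2p2 (R : realType) (q c : (R[i])^o)
    (hq : `|q| < 1) (hcq : `|c * q| < 1) :
  let P := qpoch q q / qpoch (c * q) q in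
  (exists r : R, 0 < r /\
     forall t : (R[i])^o, `|t| < r%:C ->
       exists S T : (R[i])^o,
         (fun N => \sum_(1 <= m < N) (Kc q c m * t ^+ m / (m`!)%:R)) @ \oo --> S
      /\ (fun N => \sum_(1 <= m < N) (Mc q c m * t ^+ m / (m`!)%:R)) @ \oo --> T
      /\ P * cexp S = P + T)
  /\ (forall m : nat, (1 <= m)%N -> Mc q c m = P * bellY m (Kc q c)).
Proof.
have nq : Normc.normc q < 1 by rewrite -ltcR.
have ncq : Normc.normc (c * q) < 1 by rewrite -ltcR.
(* From here on [P] is [(q;q)_oo] times the moment of order 0. *)
rewrite qpoch_ratioE//; set P := _ * _; cbv zeta.
have MP m : (0 < m)%N -> Mc q c m = P * (m`!%:R * normalized_moment q c m).
  move=> m0; rewrite McE// /P -mulrA; congr (_ * _).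
  rewrite /normalized_moment; apply: cancel_moment; first exact: moment0_neq0.
  by rewrite pnatr_eq0 -lt0n fact_gt0.
split; last first.
  move=> m m0; rewrite MP// (bellY_rec m (normalized_moment0 nq ncq))//.
  by move=> j; rewrite normalized_momentS.
(* The series of [K_m t^m/m!] is dominated with ratio [|t|/(1 - |cq|)]; the extra 4 provides the
   ratio 1/4 required by [exp_power_series]. *)
exists ((1 - Normc.normc (c * q)) / 4); split.
  by rewrite divr_gt0// subr_gt0.
move=> t ht; have {}ht : Normc.normc t < (1 - Normc.normc (c * q)) / 4 by rewrite -ltcR.
have q1 : 0 <= (1 - Normc.normc q)^-1 by rewrite invr_ge0 subr_ge0 ltW.
have [S HS] := complex_abs_cvg (fun i => nc_Kc_term_le nq ncq i ht)
  (fun N => sum_quarter_le N q1).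
have HT := sum_normalized_moment_cvg nq ncq ht HS.
(* The second sum is [P] times the series of normalized moments without its constant term 1. *)
exists S, (P * cexp S - P); split; [|split]; last by rewrite addrC subrK.
  by apply: eq_cvgn HS => N; rewrite sum_Kc_term.
have := HT; rewrite -(cvg_shiftn 1) => HT1.
rewrite -(cvg_shiftn 1).
apply: (eq_cvgn _ (seqB (seqMl (b := P) HT1) (cvg_cst P))) => N /=.
rewrite addn1 big_ord_recl normalized_moment0// expr0 mulr1 mulrDr mulr1 addrAC subrr add0r.
rewrite big_add1/= big_mkord mulr_sumr; apply: eq_bigr => j _.
rewrite /bump/= add1n MP//; apply: cancel_weight.
by rewrite pnatr_eq0 -lt0n fact_gt0.
Qed.
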